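(* (smn-Theorem) Let $A\subseteq\omega$ be an infinite c.e. set, $m,n\ge1$, let $\theta^{(n)}$ be a numbering of $\mathcal S^{(n)}_A$ satisfying condition (QGN II) and let $\theta^{(m+n)}$ be a numbering of $\mathcal S^{(m+n)}_A$ satisfying condition (QGN I). Then there is a function $s\in\mathcal R^{(m+1)}$ such that for all $i\in\omega$, $\vec y\in\omega^m$, $\vec x\in\omega^n$, $$\theta^{(n)}_{s(i,\vec y)}(\vec x)=\theta^{(m+n)}_i(\vec y,\vec x)$$ (equality of partial values).
   Context: $\omega$ is the set of natural numbers; $\mathcal R^{(n)}$ is the set of total computable functions $\omega^n\to\omega$. $\langle\cdot,\cdot\rangle:\omega^2\to\omega$ is a computable bijection with $\langle x,y\rangle\ge x,y$, extended by $\langle x\rangle=x$, $\langle x_1,\dots,x_{n+1}\rangle=\langle x_1,\langle x_2,\dots,x_{n+1}\rangle\rangle$. $\mathrm{Anf}^{(n)}_A$ is the set of partial functions from $\omega^n$ to $\omega$ whose domain is either empty or equal to $\{0,\dots,a-1\}^n$ for some $a\in A$, and $\mathcal S^{(n)}_A=\mathcal R^{(n)}\cup\mathrm{Anf}^{(n)}_A$. A numbering of a set $X$ is a surjection $\omega\to X$. The extended graph of an $n$-ary partial function $q$ is $\{\langle\langle\vec y\rangle,0\rangle:\vec y\in\omega^n\}\cup\{\langle\langle\vec x\rangle,q(\vec x)+1\rangle:\vec x\in\mathrm{dom}(q)\}$. For a numbering $\theta$ of $\mathcal S^{(n)}_A$: (QGN I) means that the extended graph of $(i,\vec x)\mapsto\theta_i(\vec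 x)$ is the range of a function in $\mathcal R^{(1)}$; (QGN II) means that for every $k\in\mathcal R^{(2)}$ there is $v\in\mathcal R^{(1)}$ such that for all $i\in\omega$, $r\in\mathcal S^{(n)}_A$: if $\{k(i,t):t\in\omega\}$ is the extended graph of $r$, then $r=\theta_{v(i)}$. *)

(* Defs.v *)
From mathcomp Require Import all_boot.
From mathcomp Require Import boolp classical_sets functions cardinality.
Set Implicit Arguments.
Unset Strict Implicit.
Unset Printing Implicit Defensive.
Local Open Scope classical_set_scope.

(* Kleene's partial recursive functions: terms, and their input/output
   relation. [Rec f g] recurses on its first argument, and [Min f] searches
   for the least value of the first argument of [f]. *)
Inductive recf : nat -> Type :=
| Zero : recf 0
| Succ : recf 1
| Proj n (i : 'I_n) : recf n
| Comp m n (f : recf m) (g : 'I_m -> recf n) : recf n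
| Rec n (f : recf n) (g : recf n.+2) : recf n.+1
| Min n (f : recf n.+1) : recf n.

Fixpoint rec_rel n (F : n.-tuple nat -> nat -> Prop)
    (G : n.+2.-tuple nat -> nat -> Prop)
    (k : nat) (xs : n.-tuple nat) (z : nat) : Prop :=
  if k is k'.+1
  then exists2 r, rec_rel F G k' xs r & G [tuple of k' :: r :: xs] z
  else F xs z.

Fixpoint eval n (p : recf n) : n.-tuple nat -> nat -> Prop :=
  match p in recf n return n.-tuple nat -> nat -> Prop with
  | Zero => fun _ z => z = 0
  | Succ => fun xs z => z = (thead xs).+1
  | Proj _ i => fun xs z => z = tnth xs i
  | Comp m _ f g => fun xs z =>
      exists2 ys : m.-tuple nat,
        forall i, eval (g i) xs (tnth ys i) & eval f ys z
  | Rec _ f g => fun xs z =>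
      rec_rel (eval f) (eval g) (thead xs) [tuple of behead xs] z
  | Min _ f => fun xs z =>
      eval f [tuple of z :: xs] 0 /\
      forall j, j < z -> exists w, eval f [tuple of j :: xs] w.+1
  end.

Definition computable n (f : n.-tuple nat -> nat) : Prop :=
  exists p : recf n, forall xs, eval p xs (f xs).

Definition ce (A : set nat) : Prop :=
  A = set0 \/
  exists2 f : 1.-tuple nat -> nat,
    computable f & range (fun t => f [tuple t]) = A.

Definition pairing (pr : nat -> nat -> nat) : Prop :=
  [/\ bijective (fun xy : nat * nat => pr xy.1 xy.2),
      forall x y, x <= pr x y /\ y <= pr x y &
      computable (fun xs : 2.-tuple nat =>
        pr (tnth xs ord0) (tnth xs ord_max))].

(* The value on the empty sequence is junk. *)
Fixpoint code (pr : nat -> nat -> nat) (s : seq nat) : nat :=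
  match s with
  | [::] => 0
  | [:: x] => x
  | x :: s' => pr x (code pr s')
  end.

Definition pfun n := n.-tuple nat -> option nat.

Definition pdom n (q : pfun n) : set (n.-tuple nat) := [set x | q x].

Definition Anf n (A : set nat) : set (pfun n) :=
  [set q | pdom q = set0 \/
           exists2 a, A a &
             pdom q = [set x : n.-tuple nat | all (fun xi => xi < a) x]].
Arguments Anf : clear implicits.

Definition Rfun n : set (pfun n) :=
  [set q | exists2 f : n.-tuple nat -> nat, computable f & q = Some \o f].
Arguments Rfun : clear implicits.

Definition Sfun n (A : set nat) : set (pfun n) := Rfun n `|` Anf n A.
Arguments Sfun : clear implicits.

Definition numbering (T : Type) (X : set T) (theta : nat -> T) : Prop :=
  range theta = X.

Definition ext_graph (pr : nat -> nat -> nat) n (q : pfun n) : set nat :=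
  [set z | exists y : n.-tuple nat, z = pr (code pr y) 0] `|`
  [set z | exists (x : n.-tuple nat) (v : nat),
             q x = Some v /\ z = pr (code pr x) v.+1].

Definition universal n (theta : nat -> pfun n) : pfun n.+1 :=
  fun x => theta (thead x) [tuple of behead x].

Definition QGN1 (pr : nat -> nat -> nat) n (theta : nat -> pfun n) : Prop :=
  exists2 e : 1.-tuple nat -> nat,
    computable e &
    range (fun t => e [tuple t]) = ext_graph pr (universal theta).

Definition QGN2 (pr : nat -> nat -> nat) n (A : set nat)
    (theta : nat -> pfun n) : Prop :=
  forall k : 2.-tuple nat -> nat, computable k ->
  exists2 v : 1.-tuple nat -> nat,
    computable v &
    forall (i : nat) (r : pfun n), Sfun n A r ->
      range (fun t => k [tuple i; t]) = ext_graph pr r ->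
      r = theta (v [tuple i]).

(* Main.v *)
(* Since [code (i :: y ++ x) = pr i (pr y_1 (... (pr y_m (code x))))], the codes
   of [i :: y] can be peeled off and compared computably. From an enumeration
   [e] of the extended graph of the universal function of [theta_mn] one
   enumerates the extended graph of [x |-> theta_mn i (y ++ x)] as follows: if
   [e t] has prefix [i :: y], replace it by the remaining suffix together with
   its value; otherwise output the trivial point [pr (code x) 0] for the suffix
   [x]. This section of [theta_mn i] is again in [Sfun n A], so (QGN II) yields
   an index computable from a code of [i :: y]. *)
Require Import Defs.
From mathcomp Require Import all_boot.
From mathcomp Require Import boolp classical_sets functions cardinality.
Set Implicit Arguments.
Unset Strict Implicit.
Unset Printing Implicit Defensive.
Local Open Scope classical_set_scope.

(** * Closure properties of the computable functions *)

Lemma computable_proj n (i : 'I_n) : computable (fun xs => tnth xs i).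
Proof. by exists (Proj i). Qed.

Lemma computable_comp m n (f : m.-tuple nat -> nat)
    (g : 'I_m -> n.-tuple nat -> nat) :
  computable f -> (forall i, computable (g i)) ->
  computable (fun xs => f [tuple g i xs | i < m]).
Proof.
move=> [p fp] /choice[q gq]; exists (Comp p q) => xs /=.
by exists [tuple g i xs | i < m] => // i; rewrite tnth_mktuple.
Qed.

Lemma computable_comp1 n (f : 1.-tuple nat -> nat) (g : n.-tuple nat -> nat) :
  computable f -> computable g -> computable (fun xs => f [tuple g xs]).
Proof.
move=> cf cg; have := computable_comp cf (fun=> cg).
congr computable; apply/funext => xs; congr f; apply/eq_from_tnth => i.
by rewrite tnth_mktuple (tnth_nth 0) ord1.
Qed.

Lemma computable_behead n (f : n.-tuple nat -> nat) :
  computable f -> computable (fun xs : n.+1.-tuple nat => f [tuple of behead xs]).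
Proof.
move=> cf; have := computable_comp cf (fun i => computable_proj (lift ord0 i)).
congr computable; apply/funext => xs; congr f; apply/eq_from_tnth => i.
by rewrite tnth_mktuple tnth_behead; congr (tnth _ _); apply/val_inj; rewrite /= inordK// ltnS.
Qed.

Lemma computable_succ n (f : n.-tuple nat -> nat) :
  computable f -> computable (fun xs => (f xs).+1).
Proof. by apply: (@computable_comp1 _ (fun xs => (thead xs).+1)); exists Succ. Qed.

Lemma computable_const n c : computable (fun _ : n.-tuple nat => c).
Proof.
elim: c => [|c /computable_succ//].
apply: (@computable_comp 0 _ (fun=> 0) (fun _ _ => 0)); first by exists Zero.
by case.
Qed.

(** [Rec] takes its recursion argument from the head of the tuple, so it is composed with the
    program for [b] followed by all projections; induction on [b xs] then follows [rec_rel]. *)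
Lemma computable_rec n (b f : n.-tuple nat -> nat)
    (g : nat -> nat -> n.-tuple nat -> nat) :
  computable b -> computable f ->
  computable (fun xs : n.+2.-tuple nat =>
    g (thead xs) (tnth xs (lift ord0 ord0)) [tuple of behead (behead xs)]) ->
  computable (fun xs => nat_rect (fun=> nat) (f xs) (fun k r => g k r xs) (b xs)).
Proof.
move=> [pb cb] [pf cf] [pg cg].
exists (Comp (Rec pf pg)
  (fun i => if unlift ord0 i is Some j then Proj j else pb)) => xs /=.
exists [tuple of b xs :: xs] => [i|].
  case: unliftP => [j|] -> /=; last exact: cb.
  by rewrite (tnth_nth 0) (tnth_nth 0).
rewrite theadE (_ : [tuple of behead [tuple of b xs :: xs]] = xs); last exact/val_inj.
elim: (b xs) => [|k IH] /=; first exact: cf.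
eexists; first exact: IH.
set r := nat_rect _ _ _ k; have := cg [tuple of k :: r :: xs].
by rewrite (_ : [tuple of behead (behead [tuple of k :: r :: xs])] = xs)//; apply/val_inj.
Qed.

Lemma computable_add n (f g : n.-tuple nat -> nat) :
  computable f -> computable g -> computable (fun xs => f xs + g xs).
Proof.
move=> cf cg.
rewrite (_ : (fun _ => _) = fun xs => nat_rect (fun=> nat) (g xs) (fun k r => r.+1) (f xs)).
  apply: (computable_rec (g := fun _ r _ => r.+1)) => //.
  exact/computable_succ/computable_proj.
by apply/funext => xs; elim: (f xs) => //= k <-; rewrite addSn.
Qed.

Lemma computable_sum n (b : n.-tuple nat -> nat) (f : nat -> n.-tuple nat -> nat) :
  computable b ->
  computable (fun xs : n.+1.-tuple nat => f (thead xs) [tuple of behead xs]) ->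
  computable (fun xs => \sum_(i < b xs) f i xs).
Proof.
move=> cb cf.
rewrite (_ : (fun _ => _) = fun xs =>
    nat_rect (fun=> nat) 0 (fun k r => r + f k xs) (b xs)).
  apply: (computable_rec (g := fun k r xs => r + f k xs)) => //.
    exact: computable_const.
  apply: computable_add; first exact: computable_proj.
  (* The recursion step sees [k :: r :: xs], while [f] expects [k :: xs]: the projections chosen
     below skip the accumulator [r]. *)
  pose h (xs : n.+1.-tuple nat) := f (thead xs) [tuple of behead xs].
  have := computable_comp (cf : computable h) (fun i =>
    computable_proj (if unlift ord0 i is Some j then lift ord0 (lift ord0 j)
                     else ord0 : 'I_n.+2)).
  congr computable; apply/funext => xs.
  case: (tupleP xs) => k {}xs; case: (tupleP xs) => r {}xs.
  transitivity (h [tuple of k :: xs]); last first.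
    by rewrite /h; congr f; apply/val_inj.
  congr h; apply/eq_from_tnth => i; rewrite tnth_mktuple.
  by case: unliftP => [j|] ->; rewrite ?tnth0// !tnthS.
by apply/funext => xs; elim: (b xs) => [|k IH]; rewrite ?big_ord0// big_ord_recr IH.
Qed.

Lemma computable_mul n (f g : n.-tuple nat -> nat) :
  computable f -> computable g -> computable (fun xs => f xs * g xs).
Proof.
move=> cf cg; have := computable_sum (f := fun _ => g) cf (computable_behead cg).
by congr computable; apply/funext => xs; rewrite sum_nat_const card_ord.
Qed.

Lemma computable_sub n (f g : n.-tuple nat -> nat) :
  computable f -> computable g -> computable (fun xs => f xs - g xs).
Proof.
move=> cf cg.
(* The predecessor is a recursion that returns its counter; iterating it gives truncated
   subtraction. *)
have cpred (m : nat) (h : m.-tuple nat -> nat) : computable h -> computable (fun xs => (h xs).-1).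
  move=> ch.
  rewrite (_ : (fun _ => _) = fun xs => nat_rect (fun=> nat) 0 (fun k r => k) (h xs)).
    apply: (computable_rec (g := fun k _ _ => k)) => //; first exact: computable_const.
    exact: computable_proj.
  by apply/funext => xs; case: (h xs).
rewrite (_ : (fun _ => _) = fun xs => nat_rect (fun=> nat) (f xs) (fun k r => r.-1) (g xs)).
  apply: (computable_rec (g := fun _ r _ => r.-1)) => //.
  exact/cpred/computable_proj.
by apply/funext => xs; elim: (g xs) => [|k IH] /=; rewrite ?subn0// subnS IH.
Qed.

(** With truncated subtraction, [(f - g) + (g - f)] vanishes exactly at equality, so subtracting it
    from 1 gives the indicator. *)
Lemma computable_eqn n (f g : n.-tuple nat -> nat) :
  computable f -> computable g -> computable (fun xs => nat_of_bool (f xs == g xs)).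
Proof.
move=> cf cg.
have := computable_sub (computable_const n 1)
  (computable_add (computable_sub cf cg) (computable_sub cg cf)).
congr computable; apply/funext => xs.
by rewrite eqn_leq -!subn_eq0 -addn_eq0; case: (_ + _).
Qed.

(** * Computability of pairing and unpairing *)

Lemma computable_pr pr n (f g : n.-tuple nat -> nat) : pairing pr ->
  computable f -> computable g -> computable (fun xs => pr (f xs) (g xs)).
Proof.
move=> [_ _ cpr] cf cg.
have cfg i : computable (if i == ord0 :> 'I_2 then f else g) by case: ifP.
have := computable_comp cpr cfg; congr computable.
by apply/funext => xs; rewrite !tnth_mktuple.
Qed.

Lemma computable_foldr pr n c : pairing pr ->
  computable (fun xs : n.-tuple nat => foldr pr c xs).
Proof.
move=> hpr; elim: n => [|n /computable_behead cn].
  have := computable_const 0 c; congr computable; apply/funext => xs.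
  by rewrite tuple0.
have := computable_pr hpr (computable_proj (ord0 : 'I_n.+1)) cn.
by congr computable; apply/funext => xs; case: (tupleP xs) => x {}xs; rewrite tnth0.
Qed.

(* A search bounded by [z] suffices to unpair [z], since [x, y <= pr x y]. *)
Lemma computable_unpair pr (w : nat -> nat -> nat) (q : nat -> nat) : pairing pr ->
  computable (fun xs : 2.-tuple nat => w (thead xs) (tnth xs (lift ord0 ord0))) ->
  (forall x y, q (pr x y) = w x y) ->
  forall n (f : n.-tuple nat -> nat), computable f -> computable (fun xs => q (f xs)).
Proof.
move=> hpr cw qE n f cf; have [[d dK Kd] lepr _] := hpr.
suff c1 : computable (fun xs : 1.-tuple nat => q (thead xs)) by apply: (computable_comp1 c1 cf).
(* By injectivity of [pr] only one term of the double sum survives the indicator, and it is [w] at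
   the two components of the argument. *)
rewrite (_ : (fun _ => _) = fun xs : 1.-tuple nat =>
   \sum_(x < (thead xs).+1) \sum_(y < (thead xs).+1) w x y * (pr x y == thead xs)).
  apply: (computable_sum (f := fun x xs => \sum_(y < (thead xs).+1) w x y * (pr x y == thead xs))).
    exact/computable_succ/computable_proj.
  apply: (computable_sum (f := fun y (xs : 2.-tuple nat) =>
    w (thead xs) y * (pr (thead xs) y == thead [tuple of behead xs]))).
    exact/computable_succ/(computable_behead (computable_proj ord0)).
  have cx := computable_behead (computable_proj (ord0 : 'I_2)).
  have cz := computable_behead (computable_behead (computable_proj (ord0 : 'I_1))).
  have cy := computable_proj (ord0 : 'I_3).
  apply: computable_mul; last exact/computable_eqn/cz/computable_pr.
  pose g i : 3.-tuple nat -> nat := fun xs =>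
    if i == ord0 :> 'I_2 then tnth [tuple of behead xs] ord0 else tnth xs ord0.
  have cg i : computable (g i) by rewrite /g; case: (i == ord0).
  have := computable_comp cw cg; congr computable; apply/funext => xs.
  by congr (w _ _); [exact: (tnth_mktuple (g^~ xs) ord0)|
                     exact: (tnth_mktuple (g^~ xs) (lift ord0 ord0))].
apply/funext => xs; set z := thead xs.
have zE : z = pr (d z).1 (d z).2 by rewrite -[LHS]Kd.
move: (d z).1 (d z).2 zE => a b ->; rewrite qE.
have prE x y : (pr x y == pr a b) = ((x, y) == (a, b)).
  exact: (can_eq dK (x, y) (a, b)).
have [lea leb] := lepr a b.
rewrite (bigD1 (Ordinal (lea : a < (pr a b).+1)))//=.
rewrite (bigD1 (Ordinal (leb : b < (pr a b).+1)))//= eqxx muln1.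
rewrite big1 => [|y]; last first.
  by rewrite prE xpair_eqE eqxx -val_eqE /= => /negPf ->; rewrite muln0.
rewrite addn0 big1 ?addn0// => x; rewrite -val_eqE /= => /negPf xa.
by apply: big1 => y _; rewrite prE xpair_eqE xa muln0.
Qed.

(** * Comparing and removing prefixes of codes *)

(** The test is a number, 0 or 1, so that it can serve as a factor in a computable function; for
    fixed [l] it unfolds to a finite composition. *)
Fixpoint eq_prefix (p1 p2 : nat -> nat) l u v : nat :=
  if l is l'.+1
  then (p1 u == p1 v) * eq_prefix p1 p2 l' (p2 u) (p2 v)
  else 1.

Lemma computable_eq_prefix p1 p2 l n (u v : n.-tuple nat -> nat) :
  (forall f : n.-tuple nat -> nat, computable f -> computable (fun xs => p1 (f xs))) ->
  (forall f : n.-tuple nat -> nat, computable f -> computable (fun xs => p2 (f xs))) ->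
  computable u -> computable v ->
  computable (fun xs => eq_prefix p1 p2 l (u xs) (v xs)).
Proof.
move=> c1 c2; elim: l u v => [|l IH] u v cu cv; first exact: computable_const.
apply: computable_mul; first by apply: computable_eqn; apply: c1.
by apply: (IH (fun xs => p2 (u xs)) (fun xs => p2 (v xs))); apply: c2.
Qed.

(** Only the first [size s] heads are inspected, so the tails [c] and [d] have no influence. *)
Lemma eq_prefixE pr p1 p2 s t c d :
  (forall x y, p1 (pr x y) = x) -> (forall x y, p2 (pr x y) = y) ->
  size s = size t ->
  eq_prefix p1 p2 (size s) (foldr pr c s) (foldr pr d t) = (s == t).
Proof.
move=> K1 K2; elim: s t => [|x s IH] [|y t]//= [st].
by rewrite !K1 !K2 IH// eqseq_cons mulnb.
Qed.

Lemma iter_foldr_pr (pr : nat -> nat -> nat) p2 s c :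
  (forall x y, p2 (pr x y) = y) -> iter (size s) p2 (foldr pr c s) = c.
Proof. by move=> K2; elim: s => //= x s IH; rewrite -iterS iterSr K2. Qed.

Lemma computable_iter p n (f : n.-tuple nat -> nat) l :
  (forall f : n.-tuple nat -> nat, computable f -> computable (fun xs => p (f xs))) ->
  computable f -> computable (fun xs => iter l p (f xs)).
Proof. by move=> cp cf; elim: l => //= l /cp. Qed.

(** A code ends in its bare last entry. Since [t] is nonempty, that entry lies in [t], and every
    entry of [s] is the left half of a pair. *)
Lemma code_cat pr (s t : seq nat) :
  0 < size t -> code pr (s ++ t) = foldr pr (code pr t) s.
Proof.
move=> t0; elim: s => //= x s ->.
by case: s => //; case: t t0.
Qed.

(** * Sections and the parameter theorem *)

(** If the domain of [q] is the cube of side [a], the section at [y] has as domain the cube of the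
    same side when all entries of [y] are below [a], and the empty set otherwise. *)
Lemma Sfun_section (A : set nat) m n (q : pfun (m + n)) (y : m.-tuple nat) :
  Sfun (m + n) A q -> Sfun n A (fun x : n.-tuple nat => q [tuple of y ++ x]).
Proof.
move=> [[f cf ->]|Aq].
  left; exists (fun x : n.-tuple nat => f [tuple of y ++ x]) => //.
  (* The entries of [y ++ x] are constants on the first [m] positions and projections of [x]
     afterwards. *)
  pose g (i : 'I_(m + n)) (x : n.-tuple nat) : nat :=
    match fintype.split i with inl j => tnth y j | inr j => tnth x j end.
  have cg i : computable (g i).
    rewrite /g; case: (fintype.split i) => j; first exact: computable_const.
    exact: computable_proj.
  have := computable_comp cf cg; congr computable; apply/funext => x; congr f.
  by apply/eq_from_tnth => i; rewrite tnth_mktuple /g; case: split_ordP => j ->;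
    rewrite ?tnth_lshift ?tnth_rshift.
right; case: Aq => [q0|[a Aa qa]].
  left; apply/seteqP; split => // x qx.
  by have : pdom q [tuple of y ++ x] by []; rewrite q0.
have dom (x : n.-tuple nat) : pdom (fun x : n.-tuple nat => q [tuple of y ++ x]) x =
    (all (fun i => i < a) y /\ all (fun i => i < a) x).
  transitivity (pdom q [tuple of y ++ x]); first by [].
  by rewrite qa /= all_cat; apply/propext; split=> [/andP//|[-> ->]].
have [ya|ya] := boolP (all (fun i => i < a) y).
  right; exists a => //; apply/funext => x; rewrite dom ya /=.
  by apply/propext; split=> [[]|].
by left; apply/seteqP; split => // x; rewrite dom (negPf ya) => -[].
Qed.

Theorem theorem4p5 (pr : nat -> nat -> nat) (hpr : pairing pr)
    (A : set nat) (hAinf : infinite_set A) (hAce : ce A)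
    (m n : nat) (hm : 1 <= m) (hn : 1 <= n)
    (theta_n : nat -> pfun n) (theta_mn : nat -> pfun (m + n))
    (hnum_n : numbering (Sfun n A) theta_n) (hII : QGN2 pr A theta_n)
    (hnum_mn : numbering (Sfun (m + n) A) theta_mn) (hI : QGN1 pr theta_mn) :
  exists2 s : m.+1.-tuple nat -> nat,
    computable s &
    forall (i : nat) (y : m.-tuple nat) (x : n.-tuple nat),
      theta_n (s [tuple of i :: y]) x = theta_mn i [tuple of y ++ x].
Proof.
have [[d dK Kd] _ _] := hpr.
pose p1 z := (d z).1; pose p2 z := (d z).2.
have K1 x y : p1 (pr x y) = x by rewrite /p1 (dK (x, y)).
have K2 x y : p2 (pr x y) = y by rewrite /p2 (dK (x, y)).
have c1 := computable_unpair (w := fun x _ => x) hpr (computable_proj _) K1.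
have c2 := computable_unpair (w := fun _ y => y) hpr (computable_proj _) K2.
have [e ce_e eE] := hI.
(* Here [u] codes an argument tuple, and [w] is 0 or a value plus one. A failed prefix test
   multiplies [w] by 0, which yields a trivial point. *)
pose k (j t : nat) := let u := p1 (e [tuple t]) in let w := p2 (e [tuple t]) in
  pr (iter m.+1 p2 u) (w * eq_prefix p1 p2 m.+1 u j).
have ck : computable (fun xs : 2.-tuple nat => k (thead xs) (tnth xs (lift ord0 ord0))).
  have cet : computable (fun xs : 2.-tuple nat => e [tuple tnth xs (lift ord0 ord0)]).
    exact/(computable_comp1 ce_e)/computable_proj.
  rewrite /k; apply: (computable_pr hpr); first exact: (computable_iter _ (c2 _) (c1 _ _ cet)).
  apply: computable_mul; first exact: c2.
  apply: computable_eq_prefix; [exact: c1|exact: c2|exact: c1|exact: computable_proj].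
have [v cv vE] := hII _ ck.
(* Ending the code of [i :: y] with a dummy 0 makes each of its [m.+1] entries the left half of a
   pair, as in the longer codes it is compared with. *)
pose s (xs : m.+1.-tuple nat) := v [tuple foldr pr 0 xs].
exists s; first exact/(computable_comp1 cv)/computable_foldr.
move=> i y x; rewrite /s; set j := foldr pr 0 _.
have Sq : Sfun n A (fun x : n.-tuple nat => theta_mn i [tuple of y ++ x]).
  by apply: Sfun_section => //; rewrite -hnum_mn; exists i.
(* By (QGN II) it remains to show that [k j] enumerates the extended graph of the section. *)
rewrite -(vE j _ Sq)// {Sq v cv vE s x}.
have eqE (S : m.+1.-tuple nat) c :
    eq_prefix p1 p2 m.+1 (foldr pr c S) j = (S == [tuple of i :: y]).
  have st : size S = size [tuple of i :: y] by rewrite !size_tuple.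
  by have := eq_prefixE c 0 K1 K2 st; rewrite (size_tuple S).
have iterE (S : m.+1.-tuple nat) c : iter m.+1 p2 (foldr pr c S) = c.
  by have := iter_foldr_pr (S : seq nat) c K2; rewrite size_tuple.
have kE t (S : m.+1.-tuple nat) (x : n.-tuple nat) w :
    e [tuple t] = pr (code pr (S ++ x)) w ->
    k j t = pr (code pr x) (w * (S == [tuple of i :: y])).
  by move=> et; rewrite /k et K1 K2 code_cat ?size_tuple// iterE eqE.
have univE (x : n.-tuple nat) : universal theta_mn [tuple of i :: y ++ x] = theta_mn i [tuple of y ++ x].
  by rewrite /universal theadE; congr (theta_mn i _); apply/val_inj.
have splitE (X : (m + n).+1.-tuple nat) :
    exists (S : m.+1.-tuple nat) (x : n.-tuple nat), tval X = S ++ x.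
  have tS : size (take m.+1 X) == m.+1 by rewrite size_takel// size_tuple ltnS leq_addr.
  have tx : size (drop m.+1 X) == n by rewrite size_drop size_tuple subSS addKn.
  by exists (Tuple tS), (Tuple tx); rewrite /= cat_take_drop.
rewrite -[[set _ | _ in _]]/(range (k j)).
apply/seteqP; split => [_ [t _ <-]|z].
  have : ext_graph pr (universal theta_mn) (e [tuple t]) by rewrite -eE; exists t.
  case=> [[X]|[X [w [Xw]]]]; have [S [x XE]] := splitE X; rewrite XE => /kE ->.
    by left; exists x.
  (* A point with a foreign prefix becomes the trivial point at [x]; one with prefix [i :: y] keeps
     its value. *)
  have [SE|_] := eqVneq S [tuple of i :: y]; last by left; exists x; rewrite muln0.
  right; exists x, w; split; last by rewrite muln1.
  by rewrite -univE -Xw; congr universal; apply/val_inj; rewrite /= XE SE.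
(* Stated for arbitrary [w], this covers trivial points, with [w = 0], and proper ones alike. *)
have onto (x : n.-tuple nat) w :
    ext_graph pr (universal theta_mn) (pr (code pr (i :: y ++ x)) w) ->
    range (k j) (pr (code pr x) w).
  rewrite -eE => -[t _ et]; exists t => //.
  by rewrite (kE t [tuple of i :: y] x w et) eqxx muln1.
case=> [[x ->]|[x [w [xw ->]]]]; apply: onto.
  by left; exists [tuple of i :: y ++ x].
by right; exists [tuple of i :: y ++ x], w; rewrite univE.
Qed.
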